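(* The following two statements are equivalent: (A) (prime power conjecture) for every positive integer $q$, if there exists a perfect difference set of order $q$, then $q$ is a prime power; (B) for every integer $n\ge2$ such that $n-1$ is not a prime power, $$\inf_{|z_1|=\cdots=|z_n|=1}\ \max_{\nu=1,\dots,n^2-n}\left|\sum_{k=1}^n z_k^\nu\right| > \sqrt{n-1},$$ where the infimum is over all $n$-tuples of unimodular complex numbers.
   Context: A perfect difference set of order $q$ is a tuple of integers $(a_1,\ldots,a_{q+1})$ such that the differences $a_i-a_j$ with $i\ne j$ represent all nonzero residues modulo $q^2+q+1$. *)

(* Defs.v *)
From HB Require Import structures.
From mathcomp Require Import all_boot all_order all_algebra.
From mathcomp Require Import complex.
From mathcomp Require Import all_classical all_reals.

Set Implicit Arguments.
Unset Strict Implicit.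
Unset Printing Implicit Defensive.

Import Order.TTheory GRing.Theory Num.Theory.

Local Open Scope classical_set_scope.
Local Open Scope ring_scope.

Definition perfect_difference_set (q : nat) (a : 'I_q.+1 -> int) : Prop :=
  let m : int := (q ^ 2 + q + 1)%N in
  forall r : int, ~ (m %| r)%Z ->
    exists i j : 'I_q.+1, i != j /\ (a i - a j = r %[mod m])%Z.

(* The exponent 0 is allowed: 1 counts as a prime power. (0, 1) is a perfect
   difference set of order 1, so the prime power conjecture needs this. *)
Definition prime_power (q : nat) : Prop :=
  exists p k : nat, prime p /\ q = (p ^ k)%N.

Definition unimodular (R : realType) (n : nat) (z : 'I_n -> R[i]) : Prop :=
  forall k, Normc.normc (z k) = 1.

(* For n >= 2 the range of nu is nonempty; the moduli are nonnegative, so the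
   default value 0 does not affect the maximum. *)
Definition max_power_sum (R : realType) (n : nat) (z : 'I_n -> R[i]) : R :=
  \big[Num.max/0]_(1 <= nu < (n ^ 2 - n).+1)
    Normc.normc (\sum_(k < n) z k ^+ nu).

Definition inf_max_power_sum (R : realType) (n : nat) : R :=
  inf [set max_power_sum z | z in @unimodular R n].

(* Main.v *)
Require Import Defs.
From HB Require Import structures.
From mathcomp Require Import all_boot all_order all_algebra.
From mathcomp Require Import cyclic separable cyclotomic complex ring.
From mathcomp Require Import all_classical all_reals all_analysis.

(** Put [q = n - 1] and [m = q^2 + q + 1], let [z] be unimodular with power sums
    [s_nu], and suppose [|s_nu|^2 <= q] for [0 < nu < m].  Expand
    [\sum_(j, k) |\sum_(a < m) (z_j / z_k)^a|^2 = \sum_(a, b < m) |s_(a - b)|^2]: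
    the diagonal [j = k] alone contributes [(q + 1) m^2] on the left, and the
    right-hand side is at most [m (q + 1)^2 + m (m - 1) q], which is the same
    number.  So equality holds throughout: every [z_j / z_k] is an [m]-th root of
    unity, [|s_nu|^2 = q] for [0 < nu < m], and Fourier inversion on [Z/m] shows
    that the exponents of the [z_k / z_0] form a perfect difference set.
    Conversely, the roots of unity attached to a perfect difference set satisfy
    [|s_nu|^2 = q].  By compactness the infimum is attained, so it is at most
    [sqrt q] exactly when a perfect difference set of order [q] exists. *)

Set Implicit Arguments.
Unset Strict Implicit.
Unset Printing Implicit Defensive.

Import Order.TTheory GRing.Theory Num.Theory.
Import numFieldNormedType.Exports.

Local Open Scope ring_scope.

(** * Roots of unity and their integer powers *)

(** ['X^m - 1] splits over an algebraically closed field and is separable in characteristic 0, so it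
    has [m] distinct roots; a group of [m] such roots contains a primitive one. *)
Lemma ex_prim_root (C : numClosedFieldType) (m : nat) :
  (0 < m)%N -> exists w : C, m.-primitive_root w.
Proof.
move=> m0; have [rs Drs] := closed_field_poly_normal ('X^m - 1 : {poly C}).
move: Drs; rewrite (monicP (monicXnsubC 1 m0)) scale1r => Drs.
have /hasP[w _ pw] : has m.-primitive_root rs.
  apply: has_prim_root => //.
  - by apply/allP => w wrs; rewrite /root_of_unity Drs root_prod_XsubC.
  - by rewrite -separable_prod_XsubC -Drs separable_Xn_sub_1 // pnatr_eq0 -lt0n.
  - by rewrite -ltnS -(size_prod_XsubC rs id) -Drs size_XnsubC.
by exists w.
Qed.

Lemma prim_root_neq0 (F : fieldType) (m : nat) (w : F) :
  m.-primitive_root w -> w != 0.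
Proof.
move=> pw; apply/eqP => w0; have := prim_expr_order pw.
by move/eqP; rewrite w0 expr0n gtn_eqF ?(prim_order_gt0 pw) // eq_sym oner_eq0.
Qed.

Lemma prim_exprz_order (F : fieldType) (m : nat) (w : F) (r : int) :
  m.-primitive_root w -> (w ^ r) ^+ m = 1.
Proof.
by move=> pw; rewrite exprnP exprzAC -exprnP (prim_expr_order pw) exp1rz.
Qed.

Lemma norm_prim_exprz (C : numClosedFieldType) (m : nat) (w : C) (r : int) :
  m.-primitive_root w -> `|w ^ r| = 1.
Proof.
move=> pw; apply/eqP; rewrite -(@pexpr_eq1 _ _ m) ?(prim_order_gt0 pw) //.
by rewrite -normrX (prim_exprz_order r pw) normr1.
Qed.

Lemma prim_exprz_mod (F : fieldType) (m : nat) (w : F) (r : int) :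
  m.-primitive_root w -> w ^ (r %% m)%Z = w ^ r.
Proof.
move=> pw; rewrite [in RHS](divz_eq r m) [RHS]expfzDr.
  by rewrite [X in w ^ X * _]mulrC -exprz_exp -exprnP (prim_expr_order pw) exp1rz
    mul1r.
exact: prim_root_neq0 pw.
Qed.

Lemma prim_exprz_eq1 (F : fieldType) (m : nat) (w : F) (r : int) :
  m.-primitive_root w -> (w ^ r == 1) = (m %| r)%Z.
Proof.
move=> pw; have m0 := prim_order_gt0 pw.
rewrite -(prim_exprz_mod _ pw).
have : (0 <= (r %% m)%Z) && ((r %% m)%Z < m%:Z).
  by rewrite modz_ge0 ?ltz_mod // -lt0n.
rewrite (sameP dvdz_mod0P eqP).
case: (r %% m)%Z => // k /= km; rewrite -exprnP -(prim_order_dvd pw).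
by apply/idP/eqP => [|[->]//]; case: k km => // k;
  rewrite ltz_nat => km /(dvdn_leq (ltn0Sn k)); rewrite leqNgt km.
Qed.

Lemma sum_expr_eq0 (F : fieldType) (m : nat) (u : F) :
  u ^+ m = 1 -> u != 1 -> \sum_(i < m) u ^+ i = 0.
Proof.
move=> um u1; apply/eqP; have /esym/eqP := subrX1 u m.
by rewrite um subrr mulf_eq0 subr_eq0 (negbTE u1).
Qed.

Lemma normC1_conj (C : numClosedFieldType) (z : C) : `|z| = 1 -> z * z^* = 1.
Proof. by move=> z1; rewrite -normCK z1 expr1n. Qed.

Lemma sqr_norm_sum (C : numClosedFieldType) (I : finType) (u : I -> C) :
  `|\sum_i u i| ^+ 2 = \sum_i \sum_j u i * (u j)^*.
Proof.
rewrite normCK rmorph_sum mulr_suml; apply: eq_bigr => i _.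
by rewrite mulr_sumr.
Qed.

(** * Unimodular tuples that meet the bound are extremal *)

Section UnimodularTuple.
Variables (C : numClosedFieldType) (q : nat) (z : 'I_q.+1 -> C).
Let m := (q ^ 2 + q + 1)%N.
Let w j k := z j * (z k)^*.
(** For unimodular [z] this is the squared modulus of the power sum of index [a - b]. Conjugate
    powers stand for the negative exponents, so both orders of [a] and [b] are covered. *)
Let t a b : C := `|\sum_k z k ^+ a * (z k)^* ^+ b| ^+ 2.
Hypothesis z1 : forall k, `|z k| = 1.

Let zz k : z k * (z k)^* = 1.
Proof. exact: normC1_conj. Qed.

Let t_sub a b : (b <= a)%N -> t a b = `|\sum_k z k ^+ (a - b)| ^+ 2.
Proof.
move=> ba; rewrite /t; congr (`| _ | ^+ 2); apply: eq_bigr => k _.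
by rewrite -{1}(subnK ba) exprD -mulrA -exprMn zz expr1n mulr1.
Qed.

Let t_sym a b : t a b = t b a.
Proof.
rewrite /t -[in LHS]norm_conjC rmorph_sum; congr (`| _ | ^+ 2).
by apply: eq_bigr => k _; rewrite rmorphM !rmorphXn /= conjCK mulrC.
Qed.

(** Both sides unfold to one fourfold sum over [j], [k], [a], [b]: the left squares a sum over [a],
    the right a sum over [k]. *)
Let fejer : \sum_j \sum_k `|\sum_(a < m) w j k ^+ a| ^+ 2 =
            \sum_(a < m) \sum_(b < m) t a b.
Proof.
transitivity (
    \sum_j \sum_k \sum_(a < m) \sum_(b < m) w j k ^+ a * (w j k ^+ b)^*).
  by apply: eq_bigr => j _; apply: eq_bigr => k _; rewrite sqr_norm_sum.
transitivity (
    \sum_j \sum_(a < m) \sum_(b < m) \sum_k w j k ^+ a * (w j k ^+ b)^*).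
  apply: eq_bigr => j _; rewrite exchange_big; apply: eq_bigr => a _.
  exact: exchange_big.
rewrite exchange_big; apply: eq_bigr => a _.
rewrite exchange_big; apply: eq_bigr => b _.
rewrite /t sqr_norm_sum; apply: eq_bigr => j _; apply: eq_bigr => k _.
rewrite /w !rmorphM !rmorphXn rmorphM /= !conjCK !exprMn; ring.
Qed.

Hypothesis bound : forall nu,
  (0 < nu < m)%N -> `|\sum_k z k ^+ nu| ^+ 2 <= q%:R.

(** Majorant of [t]: the exact value on the diagonal, the assumed bound off it. *)
Let B (a b : 'I_m) : C := if a == b then q.+1%:R ^+ 2 else q%:R.

Let tB (a b : 'I_m) : t a b <= B a b.
Proof.
rewrite /B; case: eqVneq => [->|ab].
  rewrite t_sub // subnn; under eq_bigr do rewrite expr0.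
  by rewrite sumr_const card_ord ger0_norm ?ler0n.
wlog ba : a b ab / (b < a)%N.
  move=> H; case: (ltngtP a b) => [ba|ba|/val_inj ba].
  - by rewrite t_sym; apply: H => //; rewrite eq_sym.
  - exact: H.
  - by rewrite ba eqxx in ab.
rewrite t_sub 1?ltnW //; apply: bound; rewrite subn_gt0 ba /=.
exact: leq_ltn_trans (leq_subr _ _) (ltn_ord a).
Qed.

Let m0 : (0 < m)%N. Proof. by rewrite /m addn1. Qed.

Let mE : m%:R = q%:R ^+ 2 + q%:R + 1 :> C.
Proof. by rewrite /m !natrD natrX. Qed.

(** The choice of [m] enters here: since [m - 1 = q * (q + 1)], each row sums to
    [(q + 1)^2 + q * (m - 1) = (q + 1) * m]. *)
Let sumB : \sum_a \sum_b B a b = q.+1%:R * m%:R ^+ 2.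
Proof.
have E a : \sum_b B a b = q.+1%:R ^+ 2 + q%:R * (m%:R - 1).
  rewrite (bigD1 a) //= /B eqxx; congr (_ + _).
  under eq_bigr => b ba do rewrite eq_sym (negbTE ba).
  rewrite sumr_const cardC1 card_ord -[LHS]mulr_natr; congr (_ * _).
  by rewrite -[X in _ = X%:R - _](prednK m0) -natr1 addrK.
under eq_bigr do rewrite E.
rewrite sumr_const card_ord -[LHS]mulr_natr mE -natr1; ring.
Qed.

(** The terms [j = k] of [fejer] already amount to the total of [B]. Hence the slacks [B - t] and
    the terms with [j != k] cancel, and being nonnegative they all vanish. *)
Let defect : \sum_a \sum_b (B a b - t a b) +
  \sum_j \sum_(k | k != j) `|\sum_(a < m) w j k ^+ a| ^+ 2 = 0.
Proof.
have -> : \sum_a \sum_b (B a b - t a b) =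
    \sum_a \sum_b B a b - \sum_(a < m) \sum_(b < m) t a b.
  by rewrite -sumrB; apply: eq_bigr => a _; rewrite sumrB.
rewrite -fejer sumB -addrA addrC -[RHS](subrr (q.+1%:R * m%:R ^+ 2)).
rewrite addrC; congr (_ + _); rewrite addrC -sumrB.
transitivity (\sum_(j < q.+1) - (m%:R ^+ 2 : C)); last first.
  by rewrite sumr_const card_ord mulNrn mulr_natl.
apply: eq_bigr => j _.
rewrite [X in _ - X](bigD1 j) //= opprD addrCA subrr addr0.
rewrite {1}/w zz; under eq_bigr do rewrite expr1n.
by rewrite sumr_const card_ord ger0_norm ?ler0n.
Qed.

Let defectB_ge0 (a b : 'I_m) : 0 <= B a b - t a b.
Proof. by rewrite subr_ge0. Qed.

Let defect0 : (\sum_a \sum_b (B a b - t a b) == 0) &&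
  (\sum_j \sum_(k | k != j) `|\sum_(a < m) w j k ^+ a| ^+ 2 == 0).
Proof.
rewrite -paddr_eq0 ?defect ?eqxx //.
  by apply: sumr_ge0 => a _; apply: sumr_ge0.
by apply: sumr_ge0 => j _; apply: sumr_ge0 => k _; rewrite exprn_ge0.
Qed.

Lemma extremal_power_sum nu : (0 < nu < m)%N -> `|\sum_k z k ^+ nu| ^+ 2 = q%:R.
Proof.
case/andP=> nu0 num; case/andP: defect0 => /eqP D _.
have Dn : \sum_b (B (Ordinal num) b - t nu b) = 0.
  by apply: (psumr_eq0P _ D) => // a _; apply: sumr_ge0.
(* The entry of row [nu] and column 0 is the slack of the power sum of index [nu]. *)
have := psumr_eq0P (fun b _ => defectB_ge0 _ b) Dn (i := Ordinal m0) isT.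
move/eqP; rewrite subr_eq0 /B -val_eqE /= gtn_eqF // t_sub // subn0.
by move/eqP.
Qed.

(** The vanishing term of index [j], [k] is a geometric sum in [w j k]; multiplied by [w j k - 1] it
    gives [w j k ^+ m - 1]. *)
Lemma extremal_quotient j k : j != k -> (z j * (z k)^*) ^+ m = 1.
Proof.
move=> jk; case/andP: defect0 => _ /eqP D.
have Dj : \sum_(k | k != j) `|\sum_(a < m) w j k ^+ a| ^+ 2 = 0.
  apply: (psumr_eq0P _ D) => // i _; apply: sumr_ge0 => l _.
  by rewrite exprn_ge0.
have kj : k != j by rewrite eq_sym.
have /eqP := psumr_eq0P (fun l _ => exprn_ge0 2 (normr_ge0 _)) Dj kj.
rewrite sqrf_eq0 normr_eq0 => /eqP S0.
by apply/eqP; rewrite -subr_eq0 subrX1 -/(w j k) S0 mulr0.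
Qed.

(** The Fourier coefficient of the squared power sums at [r] is [m] times the number of pairs with
    difference [r], while the extremal values make it equal to [m]; so no nonzero residue is
    missed. *)
Lemma extremal_perfect_difference_set :
  exists a : 'I_q.+1 -> int, @perfect_difference_set q a.
Proof.
have [om pom] := @ex_prim_root C m m0.
have om0 := prim_root_neq0 pom.
(* The exponents come from dividing by [z ord0], which leaves all quotients [w j k] unchanged. *)
have /all_sig[a Ha] k : {i : 'I_m | z k * (z ord0)^* = om ^+ i}.
  apply: (prim_rootP pom); case: (eqVneq k ord0) => [->|k0].
    by rewrite zz expr1n.
  exact: extremal_quotient.
have wE j k : w j k = om ^ ((a j : int) - (a k : int)).
  rewrite expfzDr // -invr_expz -!exprnP -!Ha.
  have -> : (z k * (z ord0)^*)^-1 = (z k)^* * z ord0.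
    apply: (mulIf (_ : z k * (z ord0)^* != 0)).
      by rewrite Ha expf_neq0.
    rewrite mulVf ?Ha ?expf_neq0 // -Ha.
    by rewrite mulrACA -(mulrC (z k)) !zz mulr1.
  by rewrite /w mulrACA -(mulrC (z ord0)) zz mulr1.
exists (fun k => a k : int); rewrite /perfect_difference_set -/m /= => r mr.
apply: contrapT => no.
(* If [r] is missed, no [w j k] equals [om ^ r]; for [j = k] this is because [m] does not divide
   [r]. All the geometric sums in [S0] therefore vanish. *)
have noE j k : om ^ ((a j : int) - (a k : int) - r) != 1.
  rewrite (prim_exprz_eq1 _ pom); apply/negP => H.
  case: (eqVneq j k) => jk.
    by apply: mr; move: H; rewrite jk subrr add0r rpredN.
  by apply: no; exists j, k; split => //; apply/eqP; rewrite eqz_mod_dvd.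
have omX (s : int) : (om ^ s) ^+ m = 1 by exact: prim_exprz_order.
have S0 : \sum_j \sum_k \sum_(nu < m) (w j k * om ^ (- r)) ^+ nu = 0.
  apply: big1 => j _; apply: big1 => k _; apply: sum_expr_eq0.
    by rewrite wE -expfzDr // omX.
  by rewrite wE -expfzDr.
have S1 : \sum_(nu < m) `|\sum_k z k ^+ nu| ^+ 2 * (om ^ (- r)) ^+ nu = 0.
  rewrite -[RHS]S0; under [in RHS]eq_bigr do rewrite exchange_big.
  rewrite [in RHS]exchange_big; apply: eq_bigr => nu _.
  rewrite sqr_norm_sum mulr_suml; apply: eq_bigr => j _.
  rewrite mulr_suml; apply: eq_bigr => k _.
  by rewrite /w !exprMn rmorphXn.
have S2 : \sum_(nu < m) (om ^ (- r)) ^+ nu = 0.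
  apply: sum_expr_eq0; first exact: omX.
  by rewrite (prim_exprz_eq1 _ pom) rpredN; apply/negP.
(* The same coefficient computed from the extremal values: index 0 gives [(q + 1)^2], the others
   give [q * (-1)], in total [m]. *)
have : m%:R == 0 :> C.
  rewrite -S1 (bigD1 (Ordinal m0)) //= expr0 mulr1.
  under [X in `|X| ^+ 2 + _]eq_bigr do rewrite expr0.
  rewrite sumr_const card_ord ger0_norm ?ler0n //.
  under eq_bigr => nu nu0.
    rewrite extremal_power_sum; last first.
      by rewrite ltn_ord andbT lt0n; move: nu0; rewrite -val_eqE.
    over.
  move: S2; rewrite (bigD1 (Ordinal m0)) //= expr0 => /eqP.
  rewrite addrC addr_eq0 -mulr_sumr => /eqP ->.
  by rewrite mE -natr1; apply/eqP; ring.
by rewrite pnatr_eq0 gtn_eqF.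
Qed.

End UnimodularTuple.

(** * Power sums attached to a perfect difference set *)

(** There are [(q + 1) * q] ordered pairs of distinct indices and as many nonzero residues, so each
    residue is hit exactly once. The off-diagonal terms then sum to -1 and the diagonal ones to
    [q + 1]. *)
Lemma perfect_difference_set_power_sum (C : numClosedFieldType) (q : nat)
    (a : 'I_q.+1 -> int) (om : C) (nu : nat) :
  perfect_difference_set a -> (q ^ 2 + q + 1)%N.-primitive_root om ->
  (0 < nu < q ^ 2 + q + 1)%N -> `|\sum_k (om ^ a k) ^+ nu| ^+ 2 = q%:R.
Proof.
rewrite /perfect_difference_set; set m := (q ^ 2 + q + 1)%N.
move=> /= pds pom /andP[nu0 num].
have m0 : (0 < m)%N := prim_order_gt0 pom.
have om0 := prim_root_neq0 pom.
have rlt (r : int) : (`|(r %% m)%Z| < m)%N.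
  by rewrite -ltz_nat gez0_abs ?modz_ge0 ?ltz_mod // -lt0n.
pose res r := Ordinal (rlt r).
have resE (r : int) : om ^+ res r = om ^ r.
  by rewrite exprnP /= gez0_abs ?modz_ge0 -?lt0n // prim_exprz_mod.
pose f (p : 'I_q.+1 * 'I_q.+1) := res (a p.1 - a p.2).
pose D := [set p : 'I_q.+1 * 'I_q.+1 | p.1 != p.2].
pose T := [set~ Ordinal m0].
have cardT : #|T| = (q.+1 * q)%N.
  by rewrite cardsC1 card_ord /m addn1 /= mulSnr -mulnn.
have cardD : #|D| = (q.+1 * q)%N.
  have -> : D = ~: [set (i, i) | i : 'I_q.+1].
    apply/setP => -[i j]; rewrite !inE /=; congr (~~ _).
    by apply/eqP/imsetP => [->|[k _ [-> ->]]//]; exists j.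
  rewrite cardsCs finset.setCK card_prod card_ord.
  rewrite card_imset; last by move=> i j [].
  by rewrite card_ord mulnS addnC addnK mulnC.
have sub : T \subset f @: D.
  apply/fintype.subsetP => r; rewrite !inE -val_eqE /= => r0.
  have [|i [j [ij E]]] := pds r.
    by rewrite /= => /(@dvdn_leq _ _) H; move: (ltn_ord r);
      rewrite ltnNge H // lt0n.
  apply/imsetP; exists (i, j); first by rewrite inE.
  by apply: val_inj; rewrite /= E modz_nat absz_nat modn_small.
have imE : f @: D = T.
  apply/eqP; rewrite eq_sym eqEcard sub cardT -cardD; exact: leq_imset_card.
(* A map onto a set of the same cardinality as its domain is injective. *)
have inj : {in D &, injective f} by apply/imset_injP; rewrite imE cardT cardD.
have conj r : (om ^ r)^* = om ^ (- r).
  apply: (mulfI (expfz_neq0 r om0)); rewrite -expfzDr // subrr expr0z.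
  exact/normC1_conj/norm_prim_exprz/pom.
have sumT : \sum_(r in T) (om ^+ r) ^+ nu = -1.
  apply/eqP; rewrite -addr_eq0; apply/eqP.
  have := @sum_expr_eq0 _ m (om ^+ nu).
  rewrite exprAC (prim_expr_order pom) expr1n => /(_ erefl).
  rewrite -(prim_order_dvd pom) gtnNdvd // => /(_ isT) S0.
  rewrite -[RHS]S0 [RHS](bigD1 (Ordinal m0)) //= expr0 addrC; congr (_ + _).
  by apply: eq_big => [r|r _]; rewrite ?inE // exprAC.
have termE j k :
    (om ^ a j) ^+ nu * ((om ^ a k) ^+ nu)^* = (om ^+ f (j, k)) ^+ nu.
  by rewrite /f resE rmorphXn /= conj -exprMn -expfzDr.
rewrite sqr_norm_sum pair_bigA /=.
(* [q] is written as [-1 + (1 + q)] to match the off-diagonal and diagonal parts. *)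
rewrite (bigID (mem D)) /= -[RHS](addKr 1); congr (_ + _).
  rewrite -sumT -imE (big_imset _ inj); apply: eq_bigr => -[j k] _.
  exact: termE.
transitivity (\sum_(p in ~: D) (1 : C)).
  apply: eq_big => [p|[j k]]; rewrite ?inE // negbK => /eqP /= ->.
  rewrite termE /f subrr resE expr0z expr1n //.
rewrite sumr_const cardsCs finset.setCK card_prod card_ord cardD.
by rewrite -mulnBr subSnn muln1 nat1r.
Qed.

(** * The maximum and the infimum over [R[i]] *)

Section Complex.
Variable R : realType.
Local Notation C := R[i].

(** Bridge between the norm with values in [R[i]], used above, and the real modulus of the
    definitions. *)
Lemma norm_normc (x : C) : `|x| = (Normc.normc x)%:C%C.
Proof. by case: x. Qed.

Lemma sqr_normc_le (x : C) (q : nat) :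
  (`|x| ^+ 2 <= q%:R) = (Normc.normc x <= Num.sqrt q%:R).
Proof.
have n0 : 0 <= Normc.normc x by case: x => a b; exact: sqrtr_ge0.
rewrite -[X in _ = (X <= _)](ger0_norm n0) -sqrtr_sqr ler_sqrt ?ler0n //.
rewrite norm_normc -rmorphXn -(rmorph_nat (real_complex R)) /= lecR //.
Qed.

Lemma max_power_sum_le (q : nat) (z : 'I_q.+1 -> C) :
  (max_power_sum z <= Num.sqrt q%:R) <->
  (forall nu, (0 < nu < q ^ 2 + q + 1)%N -> `|\sum_k z k ^+ nu| ^+ 2 <= q%:R).
Proof.
(* With [n = q + 1], the excluded upper end [n^2 - n + 1] of the range is exactly [m]. *)
have mE : (q.+1 ^ 2 - q.+1).+1 = (q ^ 2 + q + 1)%N.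
  by rewrite -!mulnn mulSnr addnK mulnS addn1 addnC.
rewrite /max_power_sum mE; split => [le nu nuq|le].
  rewrite sqr_normc_le; apply: le_trans le.
  apply: (@le_bigmax_seq _ R _ _ 0 nu xpredT
    (fun nu => Normc.normc (\sum_k z k ^+ nu))) => //.
  by rewrite mem_index_iota.
rewrite big_seq; apply: bigmax_le => [|nu]; first exact: sqrtr_ge0.
by rewrite mem_index_iota => /le; rewrite sqr_normc_le.
Qed.

Lemma inf_max_power_sum_le (n : nat) (z : 'I_n -> C) :
  unimodular z -> inf_max_power_sum R n <= max_power_sum z.
Proof.
move=> z1; apply: ge_inf; last by exists z.
(* The infimum is a lower bound only for a set bounded below; 0 serves as a bound. *)
exists 0 => _ [u _ <-]; rewrite /max_power_sum.
elim/big_ind: _ => // [x y x0 y0|nu _]; first by rewrite le_max x0.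
by case: (\sum_k _) => a b; exact: sqrtr_ge0.
Qed.

Lemma unimodularP (n : nat) (z : 'I_n -> C) :
  unimodular z <-> (forall k, `|z k| = 1).
Proof.
split=> z1 k; first by rewrite norm_normc z1.
by have := z1 k; rewrite norm_normc => -[].
Qed.

Lemma perfect_difference_set_inf_le (q : nat) (a : 'I_q.+1 -> int) :
  perfect_difference_set a -> inf_max_power_sum R q.+1 <= Num.sqrt q%:R.
Proof.
move=> pds; have [|om pom] := @ex_prim_root C (q ^ 2 + q + 1).
  by rewrite addn1.
apply: (@le_trans _ _ (max_power_sum (fun k => om ^ a k))).
  apply/inf_max_power_sum_le/unimodularP => k.
  exact: norm_prim_exprz pom.
apply/max_power_sum_le => nu nuq.
by rewrite (perfect_difference_set_power_sum pds pom).
Qed.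

(** * Continuity of complex-valued maps *)

Section ContinuousComplex.
Variable T : topologicalType.

(** Continuity is stated on real and imaginary parts, so that only the topology of [R] enters. *)
Definition ccontinuous (f : T -> C) :=
  continuous (fun v => complex.Re (f v) : R) /\
  continuous (fun v => complex.Im (f v) : R).

Lemma ccontinuous_cst (c : C) : ccontinuous (fun=> c).
Proof. by split=> v; exact: cst_continuous. Qed.

Lemma ccontinuousD f g :
  ccontinuous f -> ccontinuous g -> ccontinuous (fun v => f v + g v).
Proof.
move=> [fr fi] [gr gi]; split.
  have -> : (fun v => complex.Re (f v + g v)) =
      (fun v => complex.Re (f v)) + (fun v => complex.Re (g v)).
    by apply/funext => u; rewrite fctE; case: (f u) => ? ?; case: (g u).
  by move=> v; apply: continuousD; [exact: fr|exact: gr].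
have -> : (fun v => complex.Im (f v + g v)) =
    (fun v => complex.Im (f v)) + (fun v => complex.Im (g v)).
  by apply/funext => u; rewrite fctE; case: (f u) => ? ?; case: (g u).
by move=> v; apply: continuousD; [exact: fi|exact: gi].
Qed.

Lemma ccontinuousM f g :
  ccontinuous f -> ccontinuous g -> ccontinuous (fun v => f v * g v).
Proof.
move=> [fr fi] [gr gi]; split.
  have -> : (fun v => complex.Re (f v * g v)) =
      (fun v => complex.Re (f v) * complex.Re (g v)) -
      (fun v => complex.Im (f v) * complex.Im (g v)).
    by apply/funext => u; rewrite !fctE; case: (f u) => ? ?; case: (g u).
  move=> v; apply: continuousB.
    by apply: continuousM; [exact: fr|exact: gr].
  by apply: continuousM; [exact: fi|exact: gi].
have -> : (fun v => complex.Im (f v * g v)) =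
    (fun v => complex.Re (f v) * complex.Im (g v)) +
    (fun v => complex.Im (f v) * complex.Re (g v)).
  by apply/funext => u; rewrite !fctE; case: (f u) => ? ?; case: (g u).
move=> v; apply: continuousD.
  by apply: continuousM; [exact: fr|exact: gi].
by apply: continuousM; [exact: fi|exact: gr].
Qed.

Lemma ccontinuousX f nu : ccontinuous f -> ccontinuous (fun v => f v ^+ nu).
Proof.
move=> cf; elim: nu => [|nu IH].
  by under eq_fun do rewrite expr0; exact: ccontinuous_cst.
by under eq_fun do rewrite exprS; exact: ccontinuousM.
Qed.

Lemma ccontinuous_sum (I : Type) (r : seq I) (f : I -> T -> C) :
  (forall i, ccontinuous (f i)) -> ccontinuous (fun v => \sum_(i <- r) f i v).
Proof.
move=> cf; elim: r => [|i r IH].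
  by under eq_fun do rewrite big_nil; exact: ccontinuous_cst.
by under eq_fun do rewrite big_cons; exact: ccontinuousD.
Qed.

Lemma continuous_normc f :
  ccontinuous f -> continuous (fun v => Normc.normc (f v) : R).
Proof.
move=> [fr fi].
have -> : (fun v => Normc.normc (f v)) = Num.sqrt \o
    ((fun v => complex.Re (f v) * complex.Re (f v)) +
     (fun v => complex.Im (f v) * complex.Im (f v))).
  by apply/funext => u; rewrite /= !fctE; case: (f u).
move=> v; apply: continuous_comp; last exact: sqrt_continuous.
apply: continuousD.
  by apply: continuousM; exact: fr.
by apply: continuousM; exact: fi.
Qed.

Lemma continuous_bigmax (I : Type) (r : seq I) (f : I -> T -> R) :
  (forall i, continuous (f i)) ->
  continuous (fun v => \big[Num.max/0]_(i <- r) f i v).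
Proof.
move=> cf; elim: r => [|i r IH] v.
  by under eq_fun do rewrite big_nil; exact: cst_continuous.
under eq_fun do rewrite big_cons.
by apply: (@continuous_max R T _ _ v); [exact: cf|exact: IH].
Qed.

End ContinuousComplex.

(** * Compactness and the attained infimum *)

(** Real parts fill the first half of the row and imaginary parts the second, so that compactness
    can be argued in a real coordinate space. *)
Definition tuple_of_row (n : nat) (v : 'rV[R]_(n + n)) (k : 'I_n) : C :=
  (v ord0 (lshift n k) +i* v ord0 (rshift n k))%C.

Lemma tuple_of_row_surj (n : nat) (z : 'I_n -> C) :
  exists v, z = tuple_of_row v.
Proof.
exists (row_mx (\row_k complex.Re (z k)) (\row_k complex.Im (z k))).
apply/funext => k; rewrite /tuple_of_row row_mxEl row_mxEr !mxE.
by case: (z k).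
Qed.

Lemma ccontinuous_tuple_of_row (n : nat) (k : 'I_n) :
  ccontinuous (fun v => tuple_of_row v k).
Proof. by split; exact: coord_continuous. Qed.

Lemma continuous_max_power_sum (n : nat) :
  continuous (fun v : 'rV[R]_(n + n) => max_power_sum (tuple_of_row v)).
Proof.
apply: continuous_bigmax => nu; apply/continuous_normc/ccontinuous_sum => k.
exact/ccontinuousX/ccontinuous_tuple_of_row.
Qed.

(** Bounded, as each coordinate has square at most 1; closed, as an intersection of preimages of 1
    under continuous moduli. *)
Lemma compact_unimodular (n : nat) :
  compact [set v : 'rV[R]_(n + n) | unimodular (tuple_of_row v)]%classic.
Proof.
apply: bounded_closed_compact.
  exists 1; split; first exact: num_real.
  move=> M M1 v /= v1; apply: le_trans (ltW M1).
  rewrite [leLHS]mx_normrE; apply: bigmax_le => // -[i j] _ /=.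
  rewrite (ord1 i) -(splitK j).
  rewrite -[leRHS]sqrtr1 -sqrtr_sqr.
  have {}v1 k : v ord0 (lshift n k) ^+ 2 + v ord0 (rshift n k) ^+ 2 = 1.
    have /(congr1 (fun x => x ^+ 2)) := v1 k.
    by rewrite /= sqr_sqrtr ?expr1n // addr_ge0 ?sqr_ge0.
  case: (fintype.split j) => k /=; rewrite ler_sqrt // -(v1 k).
    by rewrite lerDl sqr_ge0.
  by rewrite lerDr sqr_ge0.
rewrite (_ : mkset _ = \bigcap_(k in setT)
    ((fun v => Normc.normc (tuple_of_row v k) : R) @^-1` [set x | x = 1]))%classic;
  last first.
  by apply/seteqP; split=> v /= H k; [move=> _; exact: H|exact: H].
apply: closed_bigI => k _; apply: preimage_closed; last exact: closed_eq.
by move=> v _; apply: continuous_normc; exact: ccontinuous_tuple_of_row.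
Qed.

(** The extreme value theorem on the compact set of unimodular rows, which contains the constant
    tuple 1. *)
Lemma inf_max_power_sum_attained (n : nat) :
  exists2 z : 'I_n -> C, unimodular z &
    max_power_sum z <= inf_max_power_sum R n.
Proof.
pose K := [set v : 'rV[R]_(n + n) | unimodular (tuple_of_row v)]%classic.
have one : unimodular (fun _ : 'I_n => 1 : C) by move=> k; exact: Normc.normc1.
have K0 : (K !=set0)%classic.
  by have [v vE] := tuple_of_row_surj (fun _ : 'I_n => 1 : C);
    exists v; rewrite /K /= -vE.
have [v /set_mem Kv vmin] := EVT_min_rV K0 (@compact_unimodular n)
  (continuous_subspaceT (@continuous_max_power_sum n)).
exists (tuple_of_row v) => //; apply: lb_le_inf.
  by exists (max_power_sum (fun _ : 'I_n => 1)), (fun=> 1).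
move=> _ [u u1 <-]; have [w wE] := tuple_of_row_surj u; rewrite wE.
by apply: vmin; rewrite inE /K /= -wE.
Qed.

End Complex.

Theorem corollary2 (R : realType) :
  (forall q : nat, (0 < q)%N ->
     (exists a : 'I_q.+1 -> int, @perfect_difference_set q a) -> prime_power q)
  <->
  (forall n : nat, (2 <= n)%N -> ~ prime_power (n - 1)%N ->
     Num.sqrt ((n - 1)%N%:R : R) < inf_max_power_sum R n).
Proof.
split=> [ppc n n2 npp | bnd q q0 [a pds]].
  case: n n2 npp => // q q0; rewrite subn1 /= => npp.
  rewrite ltNge; apply/negP => le_inf; apply: npp; apply: ppc => //.
  (* An infimum at most [sqrt q] yields a tuple meeting every bound, not merely approximating them;
     this is what the equality analysis requires. *)
  have [z z1 zmin] := inf_max_power_sum_attained R q.+1.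
  apply: (@extremal_perfect_difference_set R[i] q z); first exact/unimodularP.
  exact/max_power_sum_le/(le_trans zmin).
apply: contrapT => npp; have := bnd q.+1 q0; rewrite subn1 /= => /(_ npp).
by rewrite ltNge (perfect_difference_set_inf_le R pds).
Qed.
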